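(* Let $(A,\mathfrak{m})$ be a Noetherian local ring of dimension $d \geq 0$ and let $I$ be an $\mathfrak{m}$-primary ideal. Set $\mathcal{R} = A[It]$ and $\mathcal{S} = A[t]$. Then there exists $i \geq 0$ such that $H^i_{\mathcal{R}_+}(\mathcal{S})_n \neq 0$ for infinitely many $n \geq 0$.
   Context: Rings are commutative with identity. $A[t]$ is the polynomial ring in one variable, graded by degree in $t$, and $\mathcal{R} = A[It] = \bigoplus_{n\ge 0} I^n t^n \subseteq A[t]$ is the Rees algebra of $I$, with $\mathcal{R}_+ = \bigoplus_{n \ge 1} I^n t^n$. $\mathcal{S} = A[t]$ is regarded as a graded $\mathcal{R}$-module via the inclusion $\mathcal{R} \subseteq A[t]$. $H^i_{\mathcal{R}_+}(-)$ denotes the $i$-th local cohomology functor of $\mathcal{R}$-modules with support in $\mathcal{R}_+$; for a graded module it is naturally $\mathbb{Z}$-graded, and $H^i_{\mathcal{R}_+}(-)_n$ is its degree $n$ component. *)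

(* Defs.v *)
(* MathComp, with the classical sets of MathComp-Analysis. *)
From HB Require Import structures.
From mathcomp Require Import all_boot all_order all_algebra.
From mathcomp Require Import boolp classical_sets cardinality.

Set Implicit Arguments.
Unset Strict Implicit.
Unset Printing Implicit Defensive.

Import GRing.Theory.
Local Open Scope classical_set_scope.
Local Open Scope ring_scope.

Section Ideals.
Variable R : comNzRingType.
Implicit Types (J K P : set R).

Definition is_ideal J : Prop :=
  [/\ J 0, forall x y, J x -> J y -> J (x + y) & forall a x, J x -> J (a * x)].

Definition proper_ideal J : Prop := is_ideal J /\ ~ J 1.

Definition prime_ideal P : Prop :=
  proper_ideal P /\ forall x y, P (x * y) -> P x \/ P y.

Definition maximal_ideal P : Prop :=
  proper_ideal P /\ forall J, proper_ideal J -> P `<=` J -> J = P.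

Definition ideal_gen (X : set R) : set R :=
  [set x | forall J, is_ideal J -> X `<=` J -> J x].

Definition ideal_mul J K : set R :=
  ideal_gen [set z | exists x y, [/\ J x, K y & z = x * y]].

Definition ideal_pow J (n : nat) : set R := iter n (ideal_mul J) setT.

Definition radical J : set R := [set x | exists n : nat, J (x ^+ n)].

Definition primary_ideal J : Prop :=
  proper_ideal J /\ forall x y, J (x * y) -> J x \/ radical J y.

End Ideals.

Definition noetherian_ring (R : comNzRingType) : Prop :=
  forall J : set R, is_ideal J -> exists s : seq R, J = ideal_gen [set` s].

Definition local_ring (R : comNzRingType) (m : set R) : Prop :=
  maximal_ideal m /\ forall n : set R, maximal_ideal n -> n = m.

(* P 0, ..., P n is a strictly increasing chain of primes (of length n). *)
Definition prime_chain (R : comNzRingType) (n : nat) (P : nat -> set R) : Prop :=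
  (forall i, (i <= n)%N -> prime_ideal (P i)) /\
  (forall i, (i < n)%N -> P i `<` P i.+1).

Definition krull_dim (R : comNzRingType) (d : nat) : Prop :=
  (exists P : nat -> set R, prime_chain d P) /\
  (forall n (P : nat -> set R), prime_chain n P -> (n <= d)%N).

Definition primary_to (R : comNzRingType) (m J : set R) : Prop :=
  primary_ideal J /\ radical J = m.

(* V is the internal direct sum of the additive subgroups G n, n in Z. *)
Definition is_grading (V : zmodType) (G : int -> set V) : Prop :=
  [/\ forall n, G n 0 /\ (forall x y, G n x -> G n y -> G n (x - y)),
      forall x, exists (s : seq int) (c : int -> V),
        (forall n, G n (c n)) /\ x = \sum_(n <- s) c n
    & forall (s : seq int) (c : int -> V), uniq s -> (forall n, G n (c n)) ->
        \sum_(n <- s) c n = 0 -> forall n, n \in s -> c n = 0].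

Definition is_graded_ring (R : comNzRingType) (GR : int -> set R) : Prop :=
  [/\ is_grading GR, GR 0 1
    & forall i j x y, GR i x -> GR j y -> GR (i + j) (x * y)].

Definition is_graded_module (R : comNzRingType) (GR : int -> set R)
    (M : lmodType R) (G : int -> set M) : Prop :=
  is_grading G /\ forall i j r x, GR i r -> G j x -> G (i + j) (r *: x).

Section LocalCohomology.
Variables (R : comNzRingType) (GR : int -> set R).

Record gradedModule := GradedModule {
  gr_mod :> lmodType R;
  gr_comp : int -> set gr_mod;
  gr_modP : is_graded_module GR gr_comp }.

Definition homogeneous_map (M N : gradedModule) (f : M -> N) : Prop :=
  forall n x, gr_comp n x -> gr_comp n (f x).

(* Injective objects of the category of graded R-modules and degree-preserving
   R-linear maps. *)
Definition gr_injective (E : gradedModule) : Prop :=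
  forall (M N : gradedModule) (f : {linear M -> N}) (g : {linear M -> E}),
    homogeneous_map f -> homogeneous_map g -> injective f ->
    exists h : {linear N -> E}, homogeneous_map h /\ forall x, h (f x) = g x.

(* 0 -> M -> E 0 -> E 1 -> ... exact, in the graded category. *)
Record injResolution (M : gradedModule) := InjResolution {
  res_obj :> nat -> gradedModule;
  res_aug : {linear M -> res_obj 0%N};
  res_d : forall i, {linear res_obj i -> res_obj i.+1};
  res_inj : forall i, gr_injective (res_obj i);
  res_aug_homog : homogeneous_map res_aug;
  res_d_homog : forall i, homogeneous_map (res_d i);
  res_aug_inj : injective res_aug;
  res_exact0 : forall x, res_d 0 x = 0 <-> exists y, res_aug y = x;
  res_exact : forall i x, res_d i.+1 x = 0 <-> exists y, res_d i y = x }.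

(* The J-torsion functor. *)
Definition torsion (J : set R) (M : lmodType R) : set M :=
  [set x | exists k, forall r, ideal_pow J k r -> r *: x = 0].

Section Cohomology.
Variables (J : set R) (M : gradedModule) (E : injResolution M).

Definition cocycles (i : nat) (n : int) : set (E i) :=
  [set x | [/\ gr_comp n x, torsion J x & res_d E i x = 0]].

Definition coboundaries (i : nat) (n : int) : set (E i) :=
  match i return set (E i) with
  | 0 => [set 0]
  | j.+1 => [set x | exists y : E j,
                [/\ gr_comp n y, torsion J y & x = res_d E j y]]
  end.

End Cohomology.

(* H^i_J(M)_n <> 0, where H^i_J is the i-th right derived functor of the
   J-torsion functor on graded modules: H^i_J(M)_n is the quotient of cocycles
   by coboundaries, computed in any injective resolution of M (the category of
   graded modules has enough injectives, and up to isomorphism the quotient does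
   not depend on the resolution). *)
Definition local_cohomology_neq0
    (J : set R) (M : gradedModule) (i : nat) (n : int) : Prop :=
  forall E : injResolution M,
    exists x : E i, cocycles J n x /\ ~ coboundaries J n x.

End LocalCohomology.

Section IdealPowers.
Variable R : comNzRingType.
Implicit Types (X J : set R).

Lemma ideal_gen_ideal X : is_ideal (ideal_gen X).
Proof.
split=> [J [] //|x y hx hy J hJ hX|a x hx J hJ hX]; case: (hJ) => _ hD hM.
  by apply: hD; [apply: hx | apply: hy].
by apply: hM; apply: hx.
Qed.

Lemma ideal_pow_ideal J n : is_ideal (ideal_pow J n).
Proof. by case: n => [|n] //; apply: ideal_gen_ideal. Qed.

Lemma ideal_powM J i j x y :
  ideal_pow J i x -> ideal_pow J j y -> ideal_pow J (i + j) (x * y).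
Proof.
elim: i x => [|i IH] x hx hy; first by case: (ideal_pow_ideal J j) => _ _; apply.
have [h0 hD hM] := ideal_pow_ideal J (i.+1 + j).
apply: (hx [set x | ideal_pow J (i.+1 + j) (x * y)]) => [|_ [a [b [ha hb ->]]]].
  split=> [|u v hu hv|a u hu] /=; first by rewrite mul0r.
  - by rewrite mulrDl; apply: hD.
  - by rewrite -mulrA; apply: hM.
move=> K hK; apply; exists a, (b * y); split=> //; last by rewrite mulrA.
exact: IH.
Qed.

End IdealPowers.

Section Rees.
Variables (A : comNzRingType) (I : set A).

Definition rees_pred : {pred {poly A}} :=
  fun p => `[< forall n : nat, ideal_pow I n p`_n >].

Lemma rees_subring : subring_closed rees_pred.
Proof.
have hI n := ideal_pow_ideal I n.
split=> [|p q /asboolP hp /asboolP hq|p q /asboolP hp /asboolP hq];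
  apply/asboolP=> n.
- by rewrite coef1; case: n => [|n] //=; case: (hI n.+1).
- case: (hI n) => h0 hD hM; rewrite coefB; apply: hD => //.
  by rewrite -mulN1r; apply: hM.
- rewrite coefM; case: (hI n) => h0 hD _; elim/big_ind: _ => // i _.
  by have := ideal_powM (hp i) (hq (n - i)%N); rewrite subnKC ?leq_ord.
Qed.

HB.instance Definition _ :=
  GRing.isSubringClosed.Build {poly A} rees_pred rees_subring.

(* The Rees algebra A[It]. *)
Record rees := Rees { rees_val : {poly A}; _ : rees_val \in rees_pred }.

HB.instance Definition _ := [isSub for rees_val].
HB.instance Definition _ := [Choice of rees by <:].
HB.instance Definition _ := [SubChoice_isSubComNzRing of rees by <:].

Definition poly_homog (n : int) : set {poly A} :=
  [set p | forall k : nat, p`_k != 0 -> k%:Z = n].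

Definition rees_comp (n : int) : set rees := [set r | poly_homog n (val r)].

(* R_+, the direct sum of the components of degree >= 1. *)
Definition rees_plus : set rees := [set r | (val r : {poly A})`_0 = 0].

(* A[t], seen as a module over the Rees algebra by restriction of scalars. *)
Definition rees_poly : Type := {poly A}.

HB.instance Definition _ := GRing.Zmodule.on rees_poly.

Definition rees_scale (r : rees) (p : rees_poly) : rees_poly := val r * p.

Lemma rees_scaleA r s p : rees_scale r (rees_scale s p) = rees_scale (r * s) p.
Proof. by rewrite /rees_scale rmorphM mulrA. Qed.

Lemma rees_scale1 : left_id 1 rees_scale.
Proof. by move=> p; rewrite /rees_scale rmorph1 mul1r. Qed.

Lemma rees_scaleDr : right_distributive rees_scale +%R.
Proof. by move=> r p q; apply: mulrDr. Qed.

Lemma rees_scaleDl p : {morph rees_scale^~ p : r s / r + s}.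
Proof. by move=> r s; rewrite /rees_scale rmorphD mulrDl. Qed.

HB.instance Definition _ := GRing.Zmodule_isLmodule.Build rees rees_poly
  rees_scaleA rees_scale1 rees_scaleDr rees_scaleDl.

Lemma poly_homogB n p q :
  poly_homog n p -> poly_homog n q -> poly_homog n (p - q).
Proof.
move=> hp hq k; rewrite coefB; case: (eqVneq p`_k 0) => [->|/hp //].
by rewrite sub0r oppr_eq0 => /hq.
Qed.

Lemma poly_homog0 n : poly_homog n 0.
Proof. by move=> k; rewrite coef0 eqxx. Qed.

Lemma poly_homogM i j p q :
  poly_homog i p -> poly_homog j q -> poly_homog (i + j) (p * q).
Proof.
move=> hp hq k; rewrite coefM => hk.
have [l hl] : exists l : 'I_k.+1, p`_l * q`_(k - l) != 0.
  apply/existsP; apply: contraNT hk; rewrite negb_exists => /forallP h.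
  by apply/eqP; apply: big1 => l _; apply/eqP; move: (h l); rewrite negbK.
have /hp <- : p`_l != 0 by apply: contraNneq hl => ->; rewrite mul0r.
have /hq <- : q`_(k - l) != 0 by apply: contraNneq hl => ->; rewrite mulr0.
by rewrite -PoszD subnKC // leq_ord.
Qed.

Lemma poly_homog_free (s : seq int) (c : int -> {poly A}) :
  uniq s -> (forall n, poly_homog n (c n)) -> \sum_(n <- s) c n = 0 ->
  forall n, n \in s -> c n = 0.
Proof.
move=> us hc hs n ns; apply/polyP=> k; rewrite coef0; apply/eqP.
apply: contraT => hk; have kn := hc _ _ hk.
move/(congr1 (fun p : {poly A} => p`_k)): hs.
rewrite coef_sum coef0 (bigD1_seq n) //= big1 ?addr0 => [/eqP|m mn].
  by rewrite (negPf hk).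
by apply/eqP; apply: contraNT mn => /hc <-; rewrite kn.
Qed.

Lemma poly_homog_monom (p : {poly A}) (k : nat) :
  poly_homog k%:Z (p`_k *: 'X^k).
Proof.
move=> l; rewrite coefZ coefXn; case: (eqVneq l k) => [->//|_].
by rewrite mulr0 eqxx.
Qed.

Lemma poly_homog_grading : is_grading (V := rees_poly) poly_homog.
Proof.
split=> [n|p|]; last exact: poly_homog_free.
  by split; [apply: poly_homog0 | move=> p q; apply: poly_homogB].
exists [seq k%:Z | k <- index_iota 0 (size (p : {poly A}))].
exists (fun n : int => if n is Posz k
                       then (p : {poly A})`_k *: 'X^k : {poly A} else 0).
split=> [[k|k]|]; [exact: poly_homog_monom | exact: poly_homog0 |].
by rewrite big_map big_mkord -poly_def coefK.
Qed.

Lemma rees_graded_ring : is_graded_ring rees_comp.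
Proof.
split=> [|k|i j r s hr hs]; last 2 first.
- by rewrite rmorph1 coef1; case: k => //= k; rewrite eqxx.
- by rewrite /rees_comp /mkset rmorphM; apply: poly_homogM.
split=> [n|r|s c us hc hs n ns].
- split=> [|r s hr hs]; rewrite /rees_comp /mkset ?rmorph0 ?rmorphB.
    exact: poly_homog0.
  exact: poly_homogB.
- have hk (k : nat) : (val r)`_k *: 'X^k \in rees_pred.
    have /asboolP hr := valP r; apply/asboolP=> l.
    rewrite coefZ coefXn; case: (eqVneq l k) => [->|_].
      by rewrite mulr1.
    by rewrite mulr0; case: (ideal_pow_ideal I l).
  exists [seq k%:Z | k <- index_iota 0 (size (val r))].
  exists (fun n : int => if n is Posz k then Rees (hk k) else 0).
  split=> [[k|k]|]; rewrite /rees_comp /mkset.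
  + exact: poly_homog_monom.
  + by rewrite rmorph0; apply: poly_homog0.
  + apply: val_inj; rewrite rmorph_sum /= big_map.
    by rewrite big_mkord -poly_def coefK.
- apply: val_inj; rewrite rmorph0.
  apply: (@poly_homog_free s (fun n => val (c n))) => //.
  by rewrite -rmorph_sum hs rmorph0.
Qed.

Lemma rees_poly_graded : is_graded_module rees_comp (M := rees_poly) poly_homog.
Proof.
by split=> [|i j r p hr hp]; [exact: poly_homog_grading | exact: poly_homogM].
Qed.

Definition rees_gpoly : gradedModule rees_comp := GradedModule rees_poly_graded.

End Rees.

Arguments rees_plus {A} I.
Arguments rees_gpoly {A} I.

(* Main.v *)
(* Let I = (x_1, ..., x_r), let S = A[t], let K be the cochain Koszul complex of
   the x_j over A, and let E be a graded injective resolution of S. Taking r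
   iterated mapping fibres of the multiplications by the x_j turns E into a
   complex T of graded injectives with H^i(T)_n = H^i(K) t^n for n >= 0 and
   H^i(T)_n = 0 for n < 0. Since each x_j is null-homotopic on K, every H^i(K)
   is killed by I, so H^i(T) is killed by R_+. Let g be the least i such that
   H^i(K) <> 0; it exists because A/I, a quotient of H^r(K), is not zero. As T
   consists of injectives and is exact below degree g, its coboundaries in degree
   g split off, so H^g(T) embeds in H^g(Gamma T), where Gamma is the
   R_+-torsion functor. Hence H^g(Gamma T)_n <> 0 for all n >= 0. But Gamma T is
   an iterated fibre of Gamma E, so for each n >= 0 some i <= g satisfies
   H^i(Gamma E)_n <> 0, and by pigeonhole one i works for infinitely many n.
   Comparing resolutions shows that this i does not depend on E. *)
Require Import Defs.
From HB Require Import structures.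
From mathcomp Require Import all_boot all_order all_algebra.
From mathcomp Require Import boolp classical_sets cardinality.

Set Implicit Arguments.
Unset Strict Implicit.
Unset Printing Implicit Defensive.

Import GRing.Theory.
Local Open Scope classical_set_scope.
Local Open Scope ring_scope.

Lemma linear_bundle (R : comNzRingType) (U V : lmodType R) (f : U -> V) :
  linear f -> exists g : {linear U -> V}, g =1 f.
Proof.
move=> lf.
by exists (HB.pack_for {linear U -> V} f (GRing.isLinear.Build _ _ _ _ f lf)).
Qed.

(** * Gradings and graded injectives *)

Section Gradings.
Variable V : zmodType.
Variable G : int -> set V.
Hypothesis grG : is_grading G.

Lemma grading0 n : G n 0.
Proof. by case: grG => h _ _; case: (h n). Qed.

Lemma gradingB n x y : G n x -> G n y -> G n (x - y).
Proof. by case: grG => h _ _; case: (h n) => _; apply. Qed.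

Lemma gradingN n x : G n x -> G n (- x).
Proof. by move=> hx; rewrite -sub0r; apply: gradingB => //; apply: grading0. Qed.

Lemma gradingD n x y : G n x -> G n y -> G n (x + y).
Proof. by move=> hx hy; rewrite -[y]opprK; apply: gradingB => //; apply: gradingN. Qed.

Lemma gradingMn n x k : G n x -> G n (x *+ k).
Proof.
move=> hx; elim: k => [|k IH]; first exact: grading0.
by rewrite mulrS; apply: gradingD.
Qed.

(** The finite sum in [is_grading] may repeat a degree. Repetitions are merged into multiples,
    giving the duplicate-free index list that the uniqueness clause asks for. *)
Lemma grading_decomp x : exists (s : seq int) (c : int -> V),
  [/\ uniq s, forall n, G n (c n), forall n, n \notin s -> c n = 0
    & x = \sum_(n <- s) c n].
Proof.
case: grG => _ /(_ x) [s [c [hc ->]]] _.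
exists (undup s), (fun n => c n *+ count_mem n s); split.
- exact: undup_uniq.
- by move=> n; apply: gradingMn.
- by move=> n; rewrite mem_undup => /count_memPn ->; rewrite mulr0n.
- by rewrite -big_undup_iterop_count.
Qed.

End Gradings.

Lemma big_uniq_widen (V : zmodType) (s t : seq int) (c : int -> V) :
  uniq s -> uniq t -> {subset s <= t} -> (forall n, n \notin s -> c n = 0) ->
  \sum_(n <- s) c n = \sum_(n <- t) c n.
Proof.
move=> us ut st hc; rewrite [RHS](bigID (mem s)) /= [X in _ + X]big1 ?addr0.
  rewrite -[RHS]big_filter; apply: perm_big; apply: uniq_perm => //.
    exact: filter_uniq.
  move=> n; rewrite mem_filter; case: (boolP (n \in s)) => //= hn.
  by rewrite st.
by move=> n hn; apply: hc.
Qed.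

Section GradedMaps.
Variables (V W : zmodType) (G : int -> set V) (H : int -> set W).
Variable f : {additive V -> W}.
Hypotheses (grG : is_grading G) (grH : is_grading H).
Hypothesis f_homog : forall n x, G n x -> H n (f x).

(** The component of [y] in degree [n] works, since the components of [f y] are unique. *)
Lemma homog_preimage n y : H n (f y) -> exists2 y', G n y' & f y' = f y.
Proof.
move=> hy; have [s [c [us hc c0 ey]]] := grading_decomp grG y.
exists (c n) => //; apply/eqP; rewrite -subr_eq0; apply/eqP.
(* Degree [n] is forced into the index list, as [s] may omit it. *)
pose t := undup (n :: s); have nt : n \in t by rewrite mem_undup mem_head.
have ut : uniq t by apply: undup_uniq.
have ey' : y = \sum_(k <- t) c k.
  by rewrite ey; apply: big_uniq_widen => // k ks; rewrite mem_undup inE ks orbT.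
pose e k := f (c k) - (if k == n then f y else 0).
have he k : H k (e k).
  rewrite /e; apply: gradingB => //; first exact: f_homog.
  by case: eqP => [->//|_]; apply: grading0.
have [_ _ free] := grH; have := free t e ut he _ n nt; rewrite /e eqxx; apply.
rewrite sumrB -raddf_sum -ey' (bigD1_seq n) //= eqxx.
by rewrite big1 ?addr0 ?subrr // => k /negPf ->.
Qed.

Lemma homog_kernel x : f x = 0 -> exists (s : seq int) (c : int -> V),
  [/\ forall n, G n (c n), forall n, f (c n) = 0 & x = \sum_(n <- s) c n].
Proof.
move=> fx; have [s [c [us hc c0 ex]]] := grading_decomp grG x.
exists s, c; split=> // n; case: (boolP (n \in s)) => hn; last first.
  by rewrite c0 // raddf0.
have [_ _ free] := grH; apply: (free s (fun k => f (c k)) us _ _ n hn) => [k|].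
  exact: f_homog.
by rewrite -raddf_sum -ex.
Qed.

End GradedMaps.

Lemma prod_grading (V W : zmodType) (G : int -> set V) (H : int -> set W) :
  is_grading G -> is_grading H ->
  is_grading (V := (V * W)%type) (fun n => [set p | G n p.1 /\ H n p.2]).
Proof.
move=> grG grH; split=> [n|[x y]|s c us hc sc n ns].
- split=> [|p q [p1 p2] [q1 q2]]; first by split; apply: grading0.
  by split; apply: gradingB.
- have [s [c [us hc c0 ->]]] := grading_decomp grG x.
  have [t [e [ut he e0 ->]]] := grading_decomp grH y.
  exists (undup (s ++ t)), (fun n => (c n, e n)); split=> //.
  rewrite [in LHS](@big_uniq_widen _ s (undup (s ++ t))) ?undup_uniq //; last first.
    by move=> n hn; rewrite mem_undup mem_cat hn.
  rewrite [in LHS](@big_uniq_widen _ t (undup (s ++ t))) ?undup_uniq //; last first.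
    by move=> n hn; rewrite mem_undup mem_cat hn orbT.
  by apply: (big_ind3 (fun a b p => (a, b) = p)) => // a b _ a' b' _ <- <-.
- rewrite [c n]surjective_pairing.
  have [_ _ /(_ s (fun k => (c k).1)) h1] := grG.
  have [_ _ /(_ s (fun k => (c k).2)) h2] := grH.
  have e1 : \sum_(k <- s) (c k).1 = 0 by rewrite -(raddf_sum fst) sc.
  have e2 : \sum_(k <- s) (c k).2 = 0 by rewrite -(raddf_sum snd) sc.
  by rewrite h1 ?h2 // => k; case: (hc k).
Qed.

(** * Images of homogeneous maps and extension into graded injectives *)

Section ImageModule.
Variables (R : comNzRingType) (M N : lmodType R) (f : {linear M -> N}).

Definition image_pred : {pred N} := fun y => `[< exists x, f x = y >].

Lemma image_submod : submod_closed image_pred.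
Proof.
split=> [|a y z /asboolP [u <-] /asboolP [v <-]]; apply/asboolP.
  by exists 0; rewrite raddf0.
by exists (a *: u + v); rewrite linearP.
Qed.

HB.instance Definition _ := GRing.isSubmodClosed.Build R N image_pred image_submod.

Record image_module := ImageModule {
  image_val : N; _ : image_val \in image_pred }.

HB.instance Definition _ := [isSub for image_val].
HB.instance Definition _ := [Choice of image_module by <:].
HB.instance Definition _ := [SubChoice_isSubLmodule of image_module by <:].

End ImageModule.

Lemma image_modP (R : comNzRingType) (GR : int -> set R)
    (M N : gradedModule GR) (f : {linear M -> N}) :
  homogeneous_map f ->
  is_graded_module GR (M := image_module f) (fun n => [set y | gr_comp n (val y)]).
Proof.
move=> hf; have [grN scN] := gr_modP N; have [grM _] := gr_modP M.
split=> [|i j r y hr hy]; last by rewrite /mkset linearZ; apply: scN.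
split=> [n|y|s c us hc sc n ns].
- split=> [|x y hx hy]; first by rewrite /mkset raddf0; apply: grading0.
  by rewrite /mkset raddfB; apply: gradingB.
- have /asboolP [x ex] := valP y.
  have [s [c [us hc c0 exs]]] := grading_decomp grM x.
  have hi k : f (c k) \in image_pred f by apply/asboolP; exists (c k).
  exists s, (fun k => ImageModule (hi k)); split=> [n|]; first exact: hf.
  by apply: val_inj; rewrite raddf_sum /= -raddf_sum -exs.
- have [_ _ free] := grN; apply: val_inj; rewrite raddf0.
  apply: (free s (fun k => val (c k))) => //.
  by rewrite -raddf_sum sc raddf0.
Qed.

(** As [g] kills the kernel of [f], it factors through the image of [f]; injectivity of [E] is then
    applied to the inclusion of that image. *)
Lemma gr_injective_extend (R : comNzRingType) (GR : int -> set R)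
    (M N E : gradedModule GR) (f : {linear M -> N}) (g : {linear M -> E}) :
  gr_injective E -> homogeneous_map f -> homogeneous_map g ->
  (forall x, f x = 0 -> g x = 0) ->
  exists h : {linear N -> E}, homogeneous_map h /\ forall x, h (f x) = g x.
Proof.
move=> injE hf hg fg.
have preP (y : image_module f) : {x | f x = val y}.
  by apply: cid; apply/asboolP; apply: (valP y).
have g_eq x x' : f x = f x' -> g x = g x'.
  move=> e; apply/eqP; rewrite -subr_eq0 -linearB; apply/eqP/fg.
  by rewrite linearB e subrr.
have g'_lin : linear (fun y => g (sval (preP y))).
  move=> a u v; rewrite -linearP; apply: g_eq.
  by rewrite linearP !(svalP (preP _)) linearP.
have [g' g'E] := linear_bundle g'_lin.
pose F := GradedModule (image_modP hf).
have [] := injE F N (val : {linear image_module f -> N}) g'.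
- by move=> n y.
- move=> n y hy; rewrite g'E.
  have [grN _] := gr_modP N; have [grM _] := gr_modP M.
  (* The chosen preimage need not be homogeneous, but [g] takes the same value on a homogeneous
     one. *)
  have hfy : gr_comp n (f (sval (preP y))) by rewrite (svalP (preP y)).
  have [x' hx' ex'] := homog_preimage (f := f) grM grN hf hfy.
  by rewrite -(g_eq _ _ ex'); apply: hg.
- exact: val_inj.
move=> h [hh hE]; exists h; split=> // x.
have hx : f x \in image_pred f by apply/asboolP; exists x.
rewrite -[f x]/(val (ImageModule hx)) hE g'E; apply: g_eq.
by rewrite (svalP (preP _)).
Qed.

Lemma prod_graded_module (R : comNzRingType) (GR : int -> set R)
    (M N : lmodType R) (G : int -> set M) (H : int -> set N) :
  is_graded_module GR G -> is_graded_module GR H ->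
  is_graded_module GR (M := (M * N)%type) (fun n => [set p | G n p.1 /\ H n p.2]).
Proof.
move=> [grG scG] [grH scH]; split; first exact: prod_grading.
by move=> i j r p hr [h1 h2]; split; [apply: scG | apply: scH].
Qed.

Section Injectives.
Variables (R : comNzRingType) (GR : int -> set R).

(** The complexes below have bare modules as terms and carry their gradings separately, so
    injectivity is made a property of the family of components. *)
Definition injective_grading (M : lmodType R) (G : int -> set M) :=
  exists hG : is_graded_module GR G, gr_injective (GradedModule hG).

Lemma prod_injective (M N : lmodType R) (G : int -> set M) (H : int -> set N) :
  injective_grading G -> injective_grading H ->
  injective_grading (M := (M * N)%type) (fun n => [set p | G n p.1 /\ H n p.2]).
Proof.
move=> [hG injG] [hH injH]; exists (prod_graded_module hG hH).
move=> P Q f g hf hg fI.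
have [g1 g1E] : exists g1 : {linear P -> M}, g1 =1 fst \o g.
  by apply: linear_bundle => a u v; rewrite /= linearP.
have [g2 g2E] : exists g2 : {linear P -> N}, g2 =1 snd \o g.
  by apply: linear_bundle => a u v; rewrite /= linearP.
have [|h1 [h1h h1E]] := injG _ _ f g1 hf _ fI.
  by move=> n x hx; rewrite g1E; case: (hg n x hx).
have [|h2 [h2h h2E]] := injH _ _ f g2 hf _ fI.
  by move=> n x hx; rewrite g2E; case: (hg n x hx).
have [h hE] : exists h : {linear Q -> (M * N)%type}, h =1 fun x => (h1 x, h2 x).
  by apply: linear_bundle => a u v; rewrite !linearP.
exists h; split=> [n x hx|x].
  by rewrite hE; split; [apply: h1h | apply: h2h].
by rewrite hE h1E h2E g1E g2E /= -surjective_pairing.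
Qed.

(** ['M[R]_0] has a single element, so [setT] is the zero component in every degree. *)
Lemma zero_graded_module : is_graded_module GR (M := 'M[R]_0) (fun=> setT).
Proof.
split=> //; split=> [//|x|s c _ _ _ n _]; last exact: flatmx0.
by exists [::], (fun=> 0); split=> //; rewrite big_nil; apply: flatmx0.
Qed.

Lemma zero_injective : injective_grading (M := 'M[R]_0) (fun=> setT).
Proof.
exists zero_graded_module => P Q f g hf hg fI.
have [h hE] : exists h : {linear Q -> 'M[R]_0}, h =1 fun=> 0.
  by apply: linear_bundle => a u v; apply/esym/flatmx0.
by exists h; split=> // x; rewrite [LHS]flatmx0 [RHS]flatmx0.
Qed.

End Injectives.

(** * Complexes and Koszul cochains *)

(* Indices are shifted by one: cx_ob 0 sits in degree -1 and is zero except in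
   augmented resolutions, so that coboundaries are uniformly images of cx_d. *)
Record complex (R : comNzRingType) := Complex {
  cx_ob :> nat -> lmodType R;
  cx_d : forall i, {linear cx_ob i -> cx_ob i.+1};
  cx_dd : forall i x, cx_d i.+1 (cx_d i x) = 0 }.

Section Cone.
Variables (R : comNzRingType) (C : complex R) (x : R).

(** At index 0 the second factor would be the term below [C 0], taken to be zero. *)
Definition cone_ob (i : nat) : lmodType R :=
  if i is j.+1 then (C j.+1 * C j)%type : lmodType R else C 0.

Definition cone_d0 (a : C 0) : (C 1 * C 0)%type := (cx_d C 0 a, x *: a).

Lemma cone_d0_linear : linear cone_d0.
Proof.
move=> a u v; rewrite /cone_d0 linearP (scalerDr x) scalerA mulrC -scalerA //.
Qed.

HB.instance Definition _ := GRing.isLinear.Build R _ _ _ cone_d0 cone_d0_linear.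

Definition cone_dS (i : nat) (p : (C i.+1 * C i)%type) : (C i.+2 * C i.+1)%type :=
  (cx_d C i.+1 p.1, x *: p.1 - cx_d C i p.2).

Lemma cone_dS_linear i : linear (@cone_dS i).
Proof.
move=> a u v; rewrite /cone_dS /= !linearP /=.
by congr (_, _); rewrite /= addrACA -scalerDr.
Qed.

HB.instance Definition _ i :=
  GRing.isLinear.Build R _ _ _ (@cone_dS i) (@cone_dS_linear i).

Definition cone_d (i : nat) : {linear cone_ob i -> cone_ob i.+1} :=
  match i with
  | 0 => cone_d0 : {linear C 0 -> (C 1 * C 0)%type}
  | j.+1 => @cone_dS j : {linear (C j.+1 * C j)%type -> (C j.+2 * C j.+1)%type}
  end.

Lemma cone_dd i p : cone_d i.+1 (cone_d i p) = 0.
Proof.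
case: i p => [|i] p /=; rewrite /cone_dS /= cx_dd.
  by rewrite linearZ subrr.
by rewrite linearB linearZ /= cx_dd subr0 subrr.
Qed.

(* The mapping fibre of multiplication by x. *)
Definition cone := Complex cone_dd.

Definition cone_set (Q : forall i, set (C i)) (i : nat) : set (cone i) :=
  match i with
  | 0 => Q 0
  | j.+1 => [set p : C j.+1 * C j | Q j.+1 p.1 /\ Q j p.2]
  end.

End Cone.

Arguments cone_set {R C} x Q i _.

(** Exactness at index [i.+1] of the part of [C] cut out by [Q], which will be a graded strand, its
    torsion part, or everything. *)
Definition exact_on (R : comNzRingType) (C : complex R) (Q : forall i, set (C i))
    (i : nat) : Prop :=
  forall z : C i.+1, Q i.+1 z -> cx_d C i.+1 z = 0 ->
    exists2 w, Q i w & z = cx_d C i w.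

Definition stable_under (R : comNzRingType) (C : complex R) (x : R)
    (Q : forall i, set (C i)) : Prop :=
  (forall i u v, Q i u -> Q i v -> Q i (u - v)) /\
  (forall i u, Q i u -> Q i (x *: u)).

Section ConeExact.
Variables (R : comNzRingType) (C : complex R) (x : R) (Q : forall i, set (C i)).
Hypotheses (C0 : forall a : C 0, a = 0) (hQ : stable_under x Q).

Lemma stable_opp i (u : C i) : Q u -> Q (- u).
Proof. by move=> hu; have := hQ.1 _ _ _ (hQ.1 _ _ _ hu hu) hu; rewrite subrr sub0r. Qed.

(** For a cocycle [(a, b)], write [a = d w]; then [x w - b] is a cocycle one index lower, hence some
    [d v], and [(a, b) = d (w, v)]. *)
Lemma cone_exact m :
  (forall i, (i < m)%N -> exact_on Q i) ->
  forall i, (i < m)%N -> exact_on (cone_set x Q) i.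
Proof.
have [QB QZ] := hQ; move=> ex [|i] im [a b] /= [ha hb] [/= da0 xadb].
  have [w hw aw] := ex 0 im a ha da0; exists w => //.
  by rewrite /cone_d0 -aw [b]C0 [x *: w]C0.
have [w hw aw] := ex i.+1 im a ha da0; subst a.
have [||v hv vE] := ex i (ltnW im) (x *: w - b).
- by apply: QB => //; apply: QZ.
- by rewrite linearB linearZ.
exists (w, v) => //; rewrite /cone_dS /= -vE opprB addrCA subrr addr0 //.
Qed.

End ConeExact.

Lemma stable_cone (R : comNzRingType) (C : complex R) (x y : R)
    (Q : forall i, set (C i)) :
  stable_under y Q -> stable_under y (cone_set x Q).
Proof.
move=> [QB QZ]; split=> [[|i] u v|[|i] u] //=; [exact: QB| |exact: QZ|].
  by move=> [? ?] [? ?]; split; apply: QB.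
by move=> [? ?]; split; apply: QZ.
Qed.

(** Injectivity and surjectivity on cohomology at index [i.+1], the target being restricted to [Q].
    The two complexes live over different rings, so [f] is a plain family of functions. *)
Definition quasi_iso_on (A R : comNzRingType) (K : complex A) (T : complex R)
    (f : forall i, K i -> T i) (Q : forall i, set (T i)) (i : nat) : Prop :=
  (forall (z : K i.+1) w, cx_d K i.+1 z = 0 -> Q i w -> f i.+1 z = cx_d T i w ->
     exists v, z = cx_d K i v) /\
  (forall z : T i.+1, Q i.+1 z -> cx_d T i.+1 z = 0 ->
     exists y w, [/\ cx_d K i.+1 y = 0, Q i w & z = f i.+1 y + cx_d T i w]).

Definition cone_map (A R : comNzRingType) (K : complex A) (T : complex R)
    (x : A) (x' : R) (f : forall i, K i -> T i) (i : nat) :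
    cone K x i -> cone T x' i :=
  match i with
  | 0 => f 0
  | j.+1 => fun p : (K j.+1 * K j)%type =>
      (f j.+1 p.1, f j p.2) : (T j.+1 * T j)%type
  end.

Arguments cone_map {A R K T} x x' f i _.

Section QuasiIso.
Variables (A R : comNzRingType) (K : complex A) (T : complex R).
Variables (f : forall i, K i -> T i) (Q : forall i, set (T i)).
Variables (x : A) (x' : R).
Hypotheses (K0 : forall a : K 0, a = 0) (T0 : forall a : T 0, a = 0).
Hypothesis fB : forall i, {morph @f i : u v / u - v}.
Hypothesis fZ : forall i (u : K i), f (x *: u) = x' *: f u.
Hypothesis fd : forall i (u : K i), f (cx_d K i u) = cx_d T i (f u).
Hypothesis fQ : forall i (u : K i), Q (f u).
Hypothesis hQ : stable_under x' Q.

Lemma morph0 i : f (0 : K i) = 0.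
Proof. by rewrite -{1}(subrr 0) fB subrr. Qed.

Lemma morphN i (u : K i) : f (- u) = - f u.
Proof. by rewrite -sub0r fB morph0 sub0r. Qed.

Lemma morphD i (u v : K i) : f (u + v) = f u + f v.
Proof. by rewrite -[v]opprK fB morphN !opprK. Qed.

(** The five lemma for the long exact sequences of the two fibres, carried out on elements. *)
Lemma cone_map_quasi_iso :
  (forall i, quasi_iso_on f Q i) ->
  forall i, quasi_iso_on (cone_map x x' f) (cone_set x' Q) i.
Proof.
have [QB QZ] := hQ; move=> qi; case=> [|i]; split.
- move=> [a b] w /= [da0 _] hw [fa _].
  have [v ->] := (qi 0).1 _ _ da0 hw fa.
  by exists v; rewrite /cone_d0 [b]K0 [x *: v]K0.
- move=> [a b] /= [ha hb] [/= da0 /subr0_eq xadb].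
  have [y [w [dy hw ea]]] := (qi 0).2 _ ha da0; subst a.
  have [|||v xy] := (qi 0).1 (x *: y) (b - x' *: w).
  + by rewrite linearZ /= dy scaler0.
  + by apply: QB => //; apply: QZ.
  + by rewrite fZ linearB linearZ /= -xadb scalerDr addrK.
  exists (y, v), w; split=> //=; last by congr (_, _); rewrite [LHS]T0 [RHS]T0.
  by rewrite /cone_dS /= dy xy subrr.
- move=> [a b] [w v] /= [da0 /subr0_eq xadb] [hw hv] [fa fb].
  have [c ac] := (qi i.+1).1 _ _ da0 hw fa; subst a.
  (* The primitives [w] and [f c] of [f a] differ by a cocycle; correcting [c] by the class [y]
     makes them agree up to a coboundary. *)
  have [||y [u [dy hu wE]]] := (qi i).2 (w - f c).
  + exact: QB.
  + by rewrite linearB -fd fa subrr.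
  have [|||e be] := (qi i).1 (b - x *: (c + y)) (x' *: u - v).
  + rewrite linearB -xadb linearZ /= linearD dy addr0 subrr //.
  + by apply: QB => //; apply: QZ.
  + rewrite fB fb fZ; have -> : w = f (c + y) + cx_d T i u.
      by rewrite morphD -addrA -wE addrCA subrr addr0.
    rewrite linearB [cx_d T i (_ *: _)]linearZ /= scalerDr addrAC.
    by rewrite [_ + x' *: cx_d T i u]addrC addrK.
  exists (c + y, - e) => /=; rewrite /cone_dS /= linearD dy addr0 linearN opprK.
  by rewrite -be addrCA subrr addr0.
- move=> [a b] /= [ha hb] [/= da0 /subr0_eq xadb].
  have [y [w [dy hw ea]]] := (qi i.+1).2 _ ha da0; subst a.
  (* The image of [x y] bounds [b - x' w], so [x y = d v] already in [K], and [y] lifts to a cocycle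
     [(y, v)] of the fibre. *)
  have [|||v xy] := (qi i.+1).1 (x *: y) (b - x' *: w).
  + by rewrite linearZ /= dy scaler0.
  + by apply: QB => //; apply: QZ.
  + by rewrite fZ linearB linearZ /= -xadb scalerDr addrK.
  have [||e [u [de hu eE]]] := (qi i).2 (b - x' *: w - f v).
  + by apply: (QB); first (by apply: QB => //; apply: QZ).
  + by rewrite !linearB linearZ /= -xadb -fd -xy fZ scalerDr addrK subrr.
  exists (y, v + e), (w, - u); split=> /=.
  + by rewrite /cone_dS /= dy xy linearD de addr0 subrr.
  + by split=> //; apply: stable_opp hQ _ _ hu.
  + rewrite /cone_dS /= linearN opprK morphD //; congr (_, _).
    by rewrite /= addrACA -eE -[b - _ - _]addrA -opprD [x' *: w + _]addrC addrC subrK.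
Qed.

End QuasiIso.

(** * Null-homotopies and top cohomology of mapping fibres *)

Definition null_homotopic (R : comNzRingType) (C : complex R) (y : R) : Prop :=
  exists h : forall i, C i.+1 -> C i,
    (forall i, linear (h i)) /\
    forall i z, cx_d C i (h i z) + h i.+1 (cx_d C i.+1 z) = y *: z.

(* A submodule N containing the coboundaries and I C, but not the cocycle u:
   it survives taking fibres and shows that the top Koszul cohomology is nonzero. *)
Definition has_top (R : comNzRingType) (I : set R) (C : complex R) (m : nat) : Prop :=
  exists (N : set (C m.+1)) (u : C m.+1),
    [/\ forall v w, N v -> N w -> N (v - w), cx_d C m.+1 u = 0, ~ N u,
        forall w, N (cx_d C m w) & forall x v, I x -> N (x *: v)].

Section ConeHomology.
Variables (R : comNzRingType) (C : complex R) (x : R).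
Hypothesis C0 : forall a : C 0, a = 0.

(** The homotopy is [(a, b)] to [(b, 0)]. *)
Lemma cone_null_homotopic_self : null_homotopic (cone C x) x.
Proof.
pose h i : cone C x i.+1 -> cone C x i :=
  match i with
  | 0 => fun p : C 1 * C 0 => p.2
  | j.+1 => fun p : C j.+2 * C j.+1 => (p.2, 0 : C j)
  end.
exists h; split=> [[|i] a u v //=|[|i] [a b]].
- by congr (_, _); rewrite /= scaler0 addr0.
- rewrite /= [b]C0 /cone_d0 /cone_dS /= !linear0.
  by congr (_, _); rewrite /= ?add0r ?addr0.
- rewrite /= /cone_dS /=.
  by congr (_, _); rewrite /= ?linear0 ?subr0 ?addr0 // addrC subrK.
Qed.

(** The homotopy is [(a, b)] to [(h a, - h b)]; the sign matches that of the differential on the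
    second factor. *)
Lemma cone_null_homotopic y : null_homotopic C y -> null_homotopic (cone C x) y.
Proof.
move=> [h [hl hd]].
have hZ i a u : h i (a *: u) = a *: h i u.
  by have [g gE] := linear_bundle (hl i); rewrite -!gE linearZ.
have hB i u v : h i (u - v) = h i u - h i v.
  by have [g gE] := linear_bundle (hl i); rewrite -!gE linearB.
pose h' i : cone C x i.+1 -> cone C x i :=
  match i with
  | 0 => fun p : C 1 * C 0 => h 0 p.1
  | j.+1 => fun p : C j.+2 * C j.+1 => (h j.+1 p.1, - h j p.2)
  end.
exists h'; split=> [[|i] a u v|[|i] [a b]] /=.
- exact: hl.
- by rewrite !hl; congr (_, _); rewrite /= scalerN -opprD.
- rewrite /cone_d0 /cone_dS /= [b]C0 linear0 subr0 hZ.
  by congr (_, _); rewrite /= ?hd // scaler0; apply: subrr.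
- rewrite /cone_dS /= linearN opprK hB hZ opprB.
  by congr (_, _); rewrite /= ?hd // -hd addrC addrA subrK addrC.
Qed.

(** The new class is [(0, u)]. The second component of a coboundary is [x w - d w'], which lies in
    [N] because [N] contains both [I C] and the coboundaries. *)
Lemma cone_has_top I m : I x -> has_top I C m -> has_top I (cone C x) m.+1.
Proof.
move=> Ix [N [u [NB du Nu Nd NZ]]].
exists [set p : C m.+2 * C m.+1 | N p.2], (0, u); split=> //=.
- by move=> v w; apply: NB.
- by rewrite /cone_dS /= du linear0 subr0 scaler0.
- by move=> w; apply: NB; [apply: NZ | apply: Nd].
- by move=> y v; apply: NZ.
Qed.

End ConeHomology.

Section ConeGrading.
Variables (R : comNzRingType) (GR : int -> set R) (C : complex R) (x : R).
Variable G : forall i, int -> set (C i).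
Hypothesis GRx : GR 0 x.

Definition homogeneous_d := forall i n (u : C i), G n u -> G n (cx_d C i u).

Hypothesis injG : forall i, injective_grading GR (@G i).

Lemma scale0_homog i n (u : C i) : G n u -> G n (x *: u).
Proof.
by have [[_ sc] _] := injG i; move=> hu; rewrite -[n]add0r; apply: sc.
Qed.

Lemma grading_stable n : stable_under x (fun i => @G i n).
Proof.
split=> i u; last exact: scale0_homog.
by move=> v; have [[gr _] _] := injG i; apply: gradingB.
Qed.

Lemma cone_injective i :
  injective_grading GR (fun n => cone_set x (fun j => @G j n) i).
Proof. by case: i => [|i]; [exact: injG | apply: prod_injective]. Qed.

End ConeGrading.

Lemma cone_homogeneous_d (R : comNzRingType) (GR : int -> set R) (C : complex R)
    (x : R) (G : forall i, int -> set (C i)) :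
  GR 0 x -> (forall i, injective_grading GR (G i)) -> homogeneous_d G ->
  homogeneous_d (fun i n => cone_set x (fun j => G j n) i).
Proof.
move=> GRx injG hd [|i] n u /= => [hu|[h1 h2]].
  by split; [apply: hd | apply: (scale0_homog GRx injG)].
have [QB _] := grading_stable GRx injG n; split=> /=; first exact: hd.
by apply: QB; [apply: (scale0_homog GRx injG) | apply: hd].
Qed.

(** * Iterated mapping fibres: the Koszul complex of [xs] with coefficients in [C] *)

Fixpoint kosz (R : comNzRingType) (C : complex R) (xs : seq R) : complex R :=
  if xs is x :: s then cone (kosz C s) x else C.

Fixpoint kosz_set (R : comNzRingType) (C : complex R) (xs : seq R)
    (Q : forall i, set (C i)) : forall i, set (kosz C xs i) :=
  match xs with
  | [::] => Q
  | x :: s => cone_set x (@kosz_set R C s Q)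
  end.

Arguments kosz_set {R C} xs Q i _.

Section Koszul.
Variables (R : comNzRingType) (C : complex R).
Implicit Types (xs : seq R) (Q : forall i, set (C i)).
Hypothesis C0 : forall a : C 0, a = 0.

Lemma kosz0 xs (a : kosz C xs 0) : a = 0.
Proof. by elim: xs a => [|x xs IH] a /=; [exact: C0 | exact: IH]. Qed.

Lemma stable_kosz xs y Q :
  stable_under y Q -> stable_under y (kosz_set xs Q).
Proof. by move=> hQ; elim: xs => //= x xs; apply: stable_cone. Qed.

Lemma kosz_exact xs Q m :
  {in xs, forall x, stable_under x Q} ->
  (forall i, (i < m)%N -> exact_on Q i) ->
  forall i, (i < m)%N -> exact_on (kosz_set xs Q) i.
Proof.
move=> + ex; elim: xs => [|x xs IH] hx //=.
apply: cone_exact; first exact: kosz0.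
  by apply: stable_kosz; apply: hx; rewrite mem_head.
by apply: IH => y ys; apply: hx; rewrite inE ys orbT.
Qed.

Lemma kosz_set_mono xs Q Q' :
  (forall i, Q i `<=` Q' i) -> forall i, kosz_set xs Q i `<=` kosz_set xs Q' i.
Proof.
move=> QQ; elim: xs => [|x xs IH] //= [|i] /=; first exact: IH.
by move=> [a b] [ha hb]; split; apply: IH.
Qed.

(** One exponent [k] serves all components, so taking torsion commutes with iterated fibres. *)
Lemma kosz_set_torsion xs (J : set R) Q i (u : kosz C xs i) :
  kosz_set xs Q i u -> torsion J u ->
  kosz_set xs (fun j => Q j `&` torsion J (M := C j)) i u.
Proof.
elim: xs i u => [|x xs IH] //= [|i] u /=; first exact: IH.
case: u => a b [ha hb] [k hk]; split; apply: IH => //=; exists k => r hr.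
  by case: (hk r hr).
by case: (hk r hr).
Qed.

Lemma kosz_null_homotopic xs : {in xs, forall y, null_homotopic (kosz C xs) y}.
Proof.
elim: xs => [|x xs IH] //= y; rewrite inE => /predU1P [->|/IH].
  by apply: cone_null_homotopic_self; apply: kosz0.
by apply: cone_null_homotopic; apply: kosz0.
Qed.

Lemma kosz_has_top (I : set R) m xs :
  {in xs, forall x, I x} -> has_top I C m -> has_top I (kosz C xs) (size xs + m).
Proof.
move=> + top; elim: xs => [|x xs IH] //= hx.
apply: cone_has_top; first by apply: hx; rewrite mem_head.
by apply: IH => y ys; apply: hx; rewrite inE ys orbT.
Qed.

Lemma kosz_grading (GR : int -> set R) (G : forall i, int -> set (C i)) xs :
  {in xs, forall x, GR 0 x} ->
  (forall i, injective_grading GR (G i)) -> homogeneous_d G ->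
  (forall i, injective_grading GR (fun n => kosz_set xs (fun j => G j n) i)) /\
  homogeneous_d (fun i n => kosz_set xs (fun j => G j n) i).
Proof.
move=> + injG hd; elim: xs => [|x xs IH] hx //=.
have GRx : GR 0 x by apply: hx; rewrite mem_head.
have [|injK hdK] := IH; first by move=> y ys; apply: hx; rewrite inE ys orbT.
split=> [i|]; first exact: (cone_injective x injK).
exact: (cone_homogeneous_d GRx injK hdK).
Qed.

End Koszul.

Section KoszulMap.
Variables (A R : comNzRingType) (K : complex A) (T : complex R) (iota : A -> R).
Implicit Types (xs : seq A) (f : forall i, K i -> T i).

Fixpoint kosz_map xs f :
    forall i, kosz K xs i -> kosz T [seq iota x | x <- xs] i :=
  match xs return forall i, kosz K xs i -> kosz T [seq iota x | x <- xs] i with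
  | [::] => f
  | x :: s => cone_map x (iota x) (@kosz_map s f)
  end.

Arguments kosz_map : clear implicits.

(** The iterated fibre map applies [f] to each component, so pointwise identities between families
    lift; the same reason gives the next two lemmas. *)
Lemma kosz_mapD xs f1 f2 f :
  (forall i u, f i u = f1 i u + f2 i u) ->
  forall i u, kosz_map xs f i u = kosz_map xs f1 i u + kosz_map xs f2 i u.
Proof.
move=> e; elim: xs => [|x xs IH] //= [|i] u /=; first exact: IH.
by rewrite !IH.
Qed.

Lemma kosz_map_scaler xs r f f' :
  (forall i u, r *: f i u = f' i u) ->
  forall i u, r *: kosz_map xs f i u = kosz_map xs f' i u.
Proof.
move=> e; elim: xs => [|x xs IH] //= [|i] u /=; first exact: IH.
by rewrite -!IH.
Qed.

Lemma kosz_map_scalel xs c f f' :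
  (forall i u, f i (c *: u) = f' i u) ->
  forall i u, kosz_map xs f i (c *: u) = kosz_map xs f' i u.
Proof.
move=> e; elim: xs => [|x xs IH] //= [|i] u /=; first exact: IH.
by rewrite -!IH.
Qed.

Variables (f : forall i, K i -> T i).
Hypotheses (K0 : forall a : K 0, a = 0) (T0 : forall a : T 0, a = 0).
Hypothesis fB : forall i, {morph f (i:=i) : u v / u - v}.
Hypothesis fZ : forall i c (u : K i), f (c *: u) = iota c *: f u.
Hypothesis fd : forall i (u : K i), f (cx_d K i u) = cx_d T i (f u).

Lemma kosz_mapB xs i : {morph kosz_map xs f i : u v / u - v}.
Proof.
elim: xs i => [|x xs IH] //= [|i] u v /=; first exact: IH.
by rewrite !IH.
Qed.

Lemma kosz_mapZ xs i c (u : kosz K xs i) :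
  kosz_map xs f i (c *: u) = iota c *: kosz_map xs f i u.
Proof.
elim: xs i u => [|x xs IH] //= [|i] u /=; first exact: IH.
by rewrite !IH.
Qed.

Lemma kosz_map_d xs i (u : kosz K xs i) :
  kosz_map xs f i.+1 (cx_d (kosz K xs) i u) = cx_d (kosz T _) i (kosz_map xs f i u).
Proof.
elim: xs i u => [|x xs IH] //= [|i] u /=; rewrite ?/cone_d0 ?/cone_dS /=.
  by rewrite IH kosz_mapZ.
by rewrite kosz_mapB !IH kosz_mapZ.
Qed.

Lemma kosz_map_set xs (Q : forall i, set (T i)) :
  (forall i (u : K i), Q i (f u)) ->
  forall i (u : kosz K xs i), kosz_set _ Q i (kosz_map xs f i u).
Proof.
move=> fQ; elim: xs => [|x xs IH] //= [|i] u /=; first exact: IH.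
by split; apply: IH.
Qed.

Lemma kosz_map_quasi_iso xs (Q : forall i, set (T i)) :
  {in xs, forall x, stable_under (iota x) Q} -> (forall i (u : K i), Q i (f u)) ->
  (forall i, quasi_iso_on f Q i) ->
  forall i, quasi_iso_on (kosz_map xs f) (kosz_set _ Q) i.
Proof.
move=> + fQ qi; elim: xs => [|x xs IH] hx //=.
apply: cone_map_quasi_iso.
- exact: kosz0.
- exact: kosz0.
- exact: kosz_mapB.
- by move=> i u; apply: kosz_mapZ.
- exact: kosz_map_d.
- exact: kosz_map_set.
- by apply: stable_kosz; apply: hx; rewrite mem_head.
- by apply: IH => y ys; apply: hx; rewrite inE ys orbT.
Qed.

End KoszulMap.

Arguments kosz_map {A R K T} iota xs f i _.

(** * Torsion, null-homotopies and comparison of resolutions *)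

Lemma ideal_pow_le (R : comNzRingType) (J : set R) (k l : nat) :
  (k <= l)%N -> ideal_pow J l `<=` ideal_pow J k.
Proof.
move=> /subnK <-; elim: (l - k)%N => [|n IH] // r hr; apply: IH.
rewrite addSn in hr; apply: hr; first exact: ideal_pow_ideal.
by move=> _ [a [b [_ hb ->]]]; case: (ideal_pow_ideal J (n + k)) => _ _; apply.
Qed.

Section Torsion.
Variables (R : comNzRingType) (J : set R) (M : lmodType R).

Lemma torsionB (x y : M) : torsion J x -> torsion J y -> torsion J (x - y).
Proof.
move=> [k hk] [l hl]; exists (k + l)%N => r hr.
rewrite scalerBr hk ?hl ?subrr //; apply: ideal_pow_le hr.
  exact: leq_addl.
exact: leq_addr.
Qed.

Lemma torsionN (x : M) : torsion J x -> torsion J (- x).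
Proof. by move=> [k hk]; exists k => r hr; rewrite scalerN hk ?oppr0. Qed.

Lemma torsionD (x y : M) : torsion J x -> torsion J y -> torsion J (x + y).
Proof. by move=> hx /torsionN hy; rewrite -[y]opprK; apply: torsionB. Qed.

Lemma torsionZ a (x : M) : torsion J x -> torsion J (a *: x).
Proof.
by move=> [k hk]; exists k => r hr; rewrite scalerA mulrC -scalerA hk ?scaler0.
Qed.

Lemma torsion_map (N : lmodType R) (f : {linear M -> N}) (x : M) :
  torsion J x -> torsion J (f x).
Proof. by move=> [k hk]; exists k => r hr; rewrite -linearZ_LR hk ?linear0. Qed.

End Torsion.

Section NullHomotopy.
Variables (R : comNzRingType) (GR : int -> set R) (C D : complex R).
Variables (G : forall i, int -> set (C i)) (H : forall i, int -> set (D i)).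
Hypotheses (hG : forall i, is_graded_module GR (@G i)) (hdG : homogeneous_d G).
Hypotheses (hH : forall i, is_graded_module GR (@H i)) (hdH : homogeneous_d H).
Hypothesis injH : forall i, injective_grading GR (@H i.+1).
Variable phi : forall i, {linear C i -> D i}.
Hypothesis phi_homog : forall i n u, G n u -> H n (phi i u).
Hypothesis phi_d : forall i u, phi i.+1 (cx_d C i u) = cx_d D i (phi i u).
Hypothesis phi0 : forall u, phi 0 u = 0.

(** The map [phi - d h] vanishes on coboundaries, which by exactness are all the cocycles at index
    [i.+1]; it therefore extends along [d] into the injective term. *)
Lemma null_homotopy_step i (h : {linear C i.+1 -> D i}) :
  exact_on (fun=> setT : set (C _)) i ->
  (forall n u, G n u -> H n (h u)) ->
  (forall u, cx_d D i (h (cx_d C i u)) = cx_d D i (phi i u)) ->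
  exists h' : {linear C i.+2 -> D i.+1},
    (forall n u, G n u -> H n (h' u)) /\
    forall u, h' (cx_d C i.+1 u) = phi i.+1 u - cx_d D i (h u).
Proof.
move=> ex hh hE.
have [psi psiE] : exists psi : {linear C i.+1 -> D i.+1},
    psi =1 fun u => phi i.+1 u - cx_d D i (h u).
  apply: linear_bundle => a u v; rewrite !linearP /=.
  by rewrite addrACA -scalerDr.
have [hH' injE] := injH i.
have [||h' [h'h h'E]] := @gr_injective_extend _ _ (GradedModule (hG i.+1))
  (GradedModule (hG i.+2)) (GradedModule hH') (cx_d C i.+1) psi injE (@hdG i.+1).
- move=> n u hu; rewrite psiE; have [gr _] := hH'.
  by apply: (gradingB gr); [apply: phi_homog | apply: hdH; apply: hh].
- move=> u du; have [w _ ->] := ex u I du.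
  by rewrite psiE hE phi_d subrr.
exists h'; split=> [n u|u]; first exact: h'h.
by rewrite h'E psiE.
Qed.

(** The invariant [d h d = d phi] is weaker than the homotopy identity; it is what the induction
    needs, and it uses exactness only below [i]. *)
Lemma null_homotopy i :
  (forall j, (j < i)%N -> exact_on (fun=> setT : set (C _)) j) ->
  exists h : {linear C i.+1 -> D i},
  [/\ forall n u, G n u -> H n (h u),
      forall u, cx_d D i (h (cx_d C i u)) = cx_d D i (phi i u)
    & i = 0 -> forall u, h u = 0].
Proof.
elim: i => [|i IH] ex.
  have [h hE] : exists h : {linear C 1 -> D 0}, h =1 fun=> 0.
    by apply: linear_bundle => a u v; rewrite scaler0 addr0.
  exists h; split=> // [n u _|u]; last by rewrite hE phi0.
  by rewrite hE; have [gr _] := hH 0; apply: grading0.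
have [h [hh hE _]] := IH (fun j ji => ex j (ltnW ji)).
have [h' [h'h h'E]] := null_homotopy_step (ex i (ltnSn i)) hh hE.
by exists h'; split=> // u; rewrite h'E linearB cx_dd subr0.
Qed.

End NullHomotopy.

(** * Comparison of injective resolutions *)

Section ResolutionComplex.
Variables (R : comNzRingType) (GR : int -> set R) (M : gradedModule GR).
Variables (E : injResolution M) (Z : gradedModule GR) (z : {linear Z -> E 0}).
Hypotheses (zd : forall u, res_d E 0 (z u) = 0) (zh : homogeneous_map z).

(** Taking [Z = M] gives the exact augmented resolution; taking [Z] zero gives the resolution
    itself, shifted by one. *)
Definition res_ob (i : nat) : gradedModule GR := if i is j.+1 then E j else Z.

Definition res_cx_d (i : nat) : {linear res_ob i -> res_ob i.+1} :=
  match i with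
  | 0 => z
  | j.+1 => res_d E j
  end.

Lemma res_cx_dd i u : res_cx_d i.+1 (res_cx_d i u) = 0.
Proof.
case: i u => [|i] u; first exact: zd.
by apply/res_exact; exists u.
Qed.

Definition res_cx : complex R := @Complex R res_ob res_cx_d res_cx_dd.

Definition res_gr (i : nat) (n : int) : set (res_cx i) := @gr_comp _ _ (res_ob i) n.

Arguments res_gr : clear implicits.

Lemma res_grP i : is_graded_module GR (res_gr i).
Proof. exact: gr_modP (res_ob i). Qed.

Lemma res_homogeneous_d : homogeneous_d res_gr.
Proof. by case=> [|i] n u; [exact: zh | exact: res_d_homog]. Qed.

Lemma res_injective i : injective_grading GR (res_gr i.+1).
Proof.
exists (res_grP i.+1); move: (@res_inj _ _ _ E i); rewrite /res_gr /=.
by move: (res_grP i.+1); rewrite /res_gr /=; case: (E i).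
Qed.

End ResolutionComplex.

Arguments res_gr {R GR M E Z z} zd i n _.

Section Comparison.
Variables (R : comNzRingType) (GR : int -> set R) (M : gradedModule GR).
Implicit Types E : injResolution M.

Lemma res_aug_d E u : res_d E 0 (res_aug E u) = 0.
Proof. by apply/res_exact0; exists u. Qed.

Definition aug_cx E : complex R := res_cx (res_aug_d E).

Definition aug_gr E : forall i, int -> set (aug_cx E i) :=
  res_gr (res_aug_d E).

Arguments aug_gr : clear implicits.

Lemma aug_homogeneous_d E : homogeneous_d (aug_gr E).
Proof. exact: res_homogeneous_d (res_aug_homog E). Qed.

Lemma aug_exact E i : exact_on (fun=> setT : set (aug_cx E _)) i.
Proof.
case: i => [|i] u _ /=.
  by move/res_exact0 => [w <-]; exists w.
by move/res_exact => [w <-]; exists w.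
Qed.

Lemma resolution_lift E E' :
  exists f : forall i, {linear aug_cx E i -> aug_cx E' i},
    [/\ forall i n u, aug_gr E i n u -> aug_gr E' i n (f i u),
        forall i u, f i.+1 (cx_d (aug_cx E) i u) = cx_d (aug_cx E') i (f i u)
      & forall u, f 0 u = u].
Proof.
(* Sending cocycles to cocycles is what allows the next map to be extended along the
   differential. *)
pose lift i (f : {linear aug_cx E i -> aug_cx E' i}) :=
  (forall n u, aug_gr E i n u -> aug_gr E' i n (f u)) /\
  forall u, cx_d (aug_cx E) i u = 0 -> cx_d (aug_cx E') i (f u) = 0.
have step i (f : {f | lift i f}) : {f' : {f' | lift i.+1 f'} |
    forall u, sval f' (cx_d (aug_cx E) i u) = cx_d (aug_cx E') i (sval f u)}.
  apply: cid; case: f => f [fh fd] /=.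
  have [g gE] : exists g : {linear aug_cx E i -> aug_cx E' i.+1},
      g =1 fun u => cx_d (aug_cx E') i (f u).
    by apply: linear_bundle => a u v; rewrite !linearP.
  have [hG' injE] := res_injective (res_aug_d E') i.
  have [||f' [f'h f'E]] := @gr_injective_extend _ _
    (GradedModule (res_grP (res_aug_d E) i)) (GradedModule (res_grP (res_aug_d E) i.+1))
    (GradedModule hG') (cx_d (aug_cx E) i) g injE (@aug_homogeneous_d E i).
  - by move=> n u hu; rewrite gE; apply: aug_homogeneous_d; apply: fh.
  - by move=> u /fd; rewrite gE.
  have f'l : lift i.+1 f'.
    split=> [|u du]; first exact: f'h.
    by have [w _ ->] := aug_exact I du; rewrite f'E gE cx_dd.
  by exists (exist _ f' f'l) => u /=; rewrite f'E gE.
have [f0 f0E] : exists f0 : {linear aug_cx E 0 -> aug_cx E' 0}, f0 =1 id.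
  by apply: linear_bundle.
have f0l : lift 0 f0.
  split=> [n u|u /=]; rewrite f0E // => eu.
  suff -> : u = 0 by rewrite linear0.
  by apply: (@res_aug_inj _ _ _ E); rewrite linear0.
pose F := nat_rect (fun i => {f | lift i f}) (exist _ f0 f0l)
  (fun i f => sval (step i f)).
exists (fun i => sval (F i)); split=> [i|i|u]; last exact: f0E.
  by case: (svalP (F i)).
by move=> u /=; rewrite (svalP (step i (F i))).
Qed.

(** The composite [g f] of two lifts of the identity is homotopic to the identity, and linear maps
    preserve torsion; hence [f] cannot send a nonzero torsion class to zero. *)
Lemma cohomology_resolution_indep (J : set R) E E' (i : nat) (n : int) :
  (exists x : E i, cocycles J n x /\ ~ coboundaries J n x) ->
  exists x : E' i, cocycles J n x /\ ~ coboundaries J n x.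
Proof.
have [f [fh fd f0]] := resolution_lift E E'.
have [g [gh gd g0]] := resolution_lift E' E.
have phiP i0 : {p : {linear aug_cx E i0 -> aug_cx E i0} |
    forall u, p u = u - g i0 (f i0 u)}.
  by apply: cid; apply: linear_bundle => a u v; rewrite !linearP /= addrACA -scalerDr.
pose phi i0 := sval (phiP i0); have phiE i0 u : phi i0 u = u - g i0 (f i0 u).
  exact: (svalP (phiP i0)).
have grE k : is_grading (aug_gr E k) by case: (res_grP (res_aug_d E) k).
have [||||h [hh hE h0]] := null_homotopy (res_grP (res_aug_d E))
  (@aug_homogeneous_d E) (res_grP (res_aug_d E)) (@aug_homogeneous_d E)
  (res_injective (res_aug_d E)) (phi := phi) (i := i) _ _ _ _.
- by move=> j k u hu; rewrite phiE; apply: (gradingB (grE j)) => //; apply/gh/fh.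
- by move=> j u; rewrite !phiE linearB fd gd.
- by move=> u; rewrite phiE f0 g0 subrr.
- by move=> j _; apply: aug_exact.
(* One further step upgrades [d h d = d phi] to [phi = d h + h' d], whose last term dies on
   cocycles. *)
have [||h' [_ h'E]] := null_homotopy_step (res_grP (res_aug_d E))
  (@aug_homogeneous_d E) (@aug_homogeneous_d E)
  (res_injective (res_aug_d E)) (phi := phi) (h := h) _ _ (@aug_exact E i) hh hE.
- by move=> j k u hu; rewrite phiE; apply: (gradingB (grE j)) => //; apply/gh/fh.
- by move=> j u; rewrite !phiE linearB fd gd.
move=> [x [[xn xJ dx] nx]]; exists (f i.+1 x).
have dx' : cx_d (aug_cx E) i.+1 x = 0 by exact: dx.
split.
  split; [exact: fh | exact: torsion_map | ].
  by have := fd i.+1 x; rewrite dx' linear0 => /esym.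
have ex : x = g i.+1 (f i.+1 x) + cx_d (aug_cx E) i (h x).
  have := h'E x; rewrite dx' linear0 phiE => /esym /subr0_eq <-.
  by rewrite addrC subrK.
(* In degree 0 the only coboundary is 0, and the vanishing of [h] there removes the correction
   term. *)
move=> hb; apply: nx; rewrite ex {ex}; destruct i as [|i].
  by rewrite /= h0 // [f 1 x]hb !linear0 addr0.
case: hb => y [yn yJ ->]; exists (g i.+1 y + h x); split.
- by apply: (gradingD (grE i.+1)); [apply: gh | apply: hh].
- by apply: torsionD; apply: torsion_map.
- by rewrite linearD -gd.
Qed.

End Comparison.

(** * The Rees algebra acting on A[t] *)

Section Rees.
Variables (A : comNzRingType) (I : set A) (E : injResolution (rees_gpoly I)).

Let GR := @rees_comp A I.

Lemma rees_const_subproof (c : A) : c%:P \in rees_pred I.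
Proof.
apply/asboolP => n; rewrite coefC; case: n => [|n] //=.
by case: (ideal_pow_ideal I n.+1).
Qed.

Definition rees_const (c : A) : rees I := Rees (rees_const_subproof c).

Lemma rees_const_homog c : GR 0 (rees_const c).
Proof. by move=> k; rewrite coefC; case: k => //= k; rewrite eqxx. Qed.

Lemma rees_plus_coef (r : rees I) k : is_ideal I -> rees_plus I r -> I (val r)`_k.
Proof.
move=> idI hr; have [I0 _ IM] := idI.
case: k => [|k]; first by rewrite [X in I X]hr.
have /asboolP/(_ k.+1) /(ideal_pow_le (isT : (1 <= k.+1)%N)) := valP r.
by apply=> // _ [a [b [ha _ ->]]]; rewrite mulrC; apply: IM.
Qed.

Definition zero_gm : gradedModule GR := GradedModule (@zero_graded_module _ GR).

Lemma zero_to_res_d u : res_d E 0 ((\0 : {linear zero_gm -> E 0}) u) = 0.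
Proof. exact: linear0. Qed.

Definition base_res : complex (rees I) := res_cx zero_to_res_d.

Definition base_gr : forall i, int -> set (base_res i) := res_gr zero_to_res_d.

Definition base_ob (i : nat) : lmodType A :=
  if i is 1%N then A^o : lmodType A else 'M[A]_0 : lmodType A.

Definition base_d (i : nat) : {linear base_ob i -> base_ob i.+1} := \0.

Lemma base_dd i u : base_d i.+1 (base_d i u) = 0.
Proof. by []. Qed.

Definition base : complex A := Complex base_dd.

(* base is A in degree 0; base_map 'X^n identifies A with H^0(E)_n = S_n = A t^n. *)
Definition base_map (p : {poly A}) (i : nat) : base i -> base_res i :=
  match i with
  | 1%N => fun a : A => res_aug E (a%:P * p : {poly A})
  | _ => fun=> 0
  end.

Arguments base_gr : clear implicits.

Lemma base0 (a : base 0) : a = 0.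
Proof. exact: flatmx0. Qed.

Lemma base_res0 (a : base_res 0) : a = 0.
Proof. exact: flatmx0. Qed.

Lemma base_mapB p i : {morph base_map p (i:=i) : u v / u - v}.
Proof.
case: i => [|[|i]] u v; rewrite /= ?subrr //.
by rewrite -linearB; congr (res_aug E _); rewrite polyCB mulrBl.
Qed.

Lemma base_mapZ p i c (u : base i) : base_map p (c *: u) = rees_const c *: base_map p u.
Proof.
case: i u => [|[|i]] u; rewrite /= ?scaler0 //.
by rewrite -linearZ; congr (res_aug E _); rewrite polyCM -mulrA.
Qed.

Lemma base_map_d p i (u : base i) :
  base_map p (cx_d base i u) = cx_d base_res i (base_map p u).
Proof.
case: i u => [|[|i]] u; rewrite /= ?linear0 //.
  by rewrite polyC0 mul0r linear0.
by rewrite res_aug_d.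
Qed.

(** Arbitrary [p] are allowed because the Rees algebra does not preserve the monomials ['X^n];
    additivity lets them be expanded again. *)
Lemma base_mapD p q i (u : base i) :
  base_map (p + q) u = base_map p u + base_map q u.
Proof.
case: i u => [|[|i]] u; rewrite /= ?addr0 //.
by rewrite -linearD; congr (res_aug E _); rewrite mulrDr.
Qed.

Lemma base_map_scaler r p i (u : base i) : r *: base_map p u = base_map (val r * p) u.
Proof.
case: i u => [|[|i]] u; rewrite /= ?scaler0 //.
by rewrite -linearZ; congr (res_aug E _); rewrite mulrCA.
Qed.

Lemma base_map_scalel c p i (u : base i) : base_map p (c *: u) = base_map (c *: p) u.
Proof.
case: i u => [|[|i]] u //=.
by congr (res_aug E _); rewrite polyCM -mul_polyC mulrCA mulrA.
Qed.

Lemma base_gr_injective i : injective_grading GR (base_gr i).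
Proof.
case: i => [|i]; last exact: res_injective.
exact: zero_injective.
Qed.

Lemma base_homogeneous_d : homogeneous_d base_gr.
Proof.
have zh : homogeneous_map (\0 : {linear zero_gm -> E 0}).
  by move=> n u _; case: (gr_modP (E 0)) => gr _; apply: grading0.
exact: (res_homogeneous_d zh).
Qed.

Lemma base_map_homog n i (u : base i) : base_gr i n%:Z (base_map 'X^n u).
Proof.
case: i u => [|[|i]] u //=.
  apply: res_aug_homog; rewrite mul_polyC => k.
  by rewrite coefZ coefXn; case: (eqVneq k n) => [->|_] //; rewrite mulr0 eqxx.
by case: (gr_modP (E i.+1)) => gr _; apply: grading0.
Qed.

Lemma base_stable c n : stable_under (rees_const c) (fun i => base_gr i n).
Proof. exact: (grading_stable (@rees_const_homog c) base_gr_injective n). Qed.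

Lemma res_cocycle0 n (z : E 0) : gr_comp n z -> res_d E 0 z = 0 ->
  exists2 p : {poly A}, poly_homog n p & z = res_aug E (p : rees_poly A).
Proof.
move=> hz /res_exact0 [y yz]; subst z.
have [gM _] := gr_modP (rees_gpoly I); have [gE _] := gr_modP (E 0).
have [p hp pE] := homog_preimage (f := res_aug E) gM gE (@res_aug_homog _ _ _ E) hz.
by exists p.
Qed.

Lemma res_cocycleS n i (z : E i.+1) : gr_comp n z -> res_d E i.+1 z = 0 ->
  exists2 w, gr_comp n w & z = res_d E i w.
Proof.
move=> hz /res_exact [y yz]; subst z.
have [gM _] := gr_modP (E i); have [gE _] := gr_modP (E i.+1).
have [w hw wE] := homog_preimage (f := res_d E i) gM gE (@res_d_homog _ _ _ E i) hz.
by exists w.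
Qed.

(** Polynomials have no component in negative degree, so no cohomology remains there. *)
Lemma base_exact_neg k i : exact_on (fun j => base_gr j (Negz k)) i.
Proof.
case: i => [|i] z hz dz; last exact: res_cocycleS.
have [p hp ->] := res_cocycle0 hz dz; exists 0 => //=.
suff -> : p = 0 by rewrite !linear0.
by apply/polyP => j; rewrite coef0; apply/eqP; apply: contraT => /hp.
Qed.

Lemma base_quasi_iso n i : quasi_iso_on (base_map 'X^n) (fun j => base_gr j n%:Z) i.
Proof.
case: i => [|i]; split.
- move=> a w _ _ /=; rewrite -(linear0 (res_aug E)) => /res_aug_inj e.
  exists 0; move/(congr1 (fun p : {poly A} => p`_n)): e.
  by rewrite coefMXn ltnn subnn coefC coef0.
- move=> z hz dz; have [p hp ->] := res_cocycle0 hz dz.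
  exists (p`_n), 0; split=> //=; rewrite addr0; congr (res_aug E _).
  rewrite mul_polyC; apply/polyP => j; rewrite coefZ coefXn.
  case: eqVneq => [->|jn]; first by rewrite mulr1.
  by rewrite mulr0; apply/eqP; apply: contraNT jn => /hp [->].
- by move=> a w _ _ _; exists 0; apply: flatmx0.
- move=> z hz dz; have [w hw ->] := res_cocycleS hz dz.
  by exists 0, w; split=> //=; rewrite add0r.
Qed.

(** The submodule is [I] and the class is that of 1 in [A/I]. *)
Lemma base_has_top : is_ideal I -> ~ I 1 -> has_top I base 0.
Proof.
move=> [I0 ID IM] I1; exists I, (1 : A); split=> //.
- by move=> v w hv hw; apply: ID => //; rewrite -mulN1r; apply: IM.
- by move=> x v hx; rewrite -[x *: v]/(x * v) mulrC; apply: IM.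
Qed.

(** * Koszul cohomology of generators of [I] *)

Variable xs : seq A.
Hypotheses (I_gen : I = ideal_gen [set` xs]) (I_proper : ~ I 1).

Let K := kosz base xs.
Let T := kosz base_res [seq rees_const x | x <- xs].
Let GT (i : nat) (n : int) : set (T i) := kosz_set _ (fun j => base_gr j n) i.
Let F (p : {poly A}) (i : nat) : K i -> T i := kosz_map rees_const xs (base_map p) i.

Arguments GT : clear implicits.
Arguments F : clear implicits.

Let idI : is_ideal I.
Proof. by rewrite I_gen; apply: ideal_gen_ideal. Qed.

Let GT_structure :
  (forall i, injective_grading GR (GT i)) /\ homogeneous_d GT.
Proof.
apply: (kosz_grading _ base_gr_injective base_homogeneous_d).
by move=> y /mapP [c _ ->]; apply: rees_const_homog.
Qed.

Let GT_injective := GT_structure.1.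
Let GT_homogeneous_d := GT_structure.2.

Let GT_grading i : is_grading (GT i).
Proof. by case: (GT_injective i) => -[]. Qed.

Let F_d p i (u : K i) : F p i.+1 (cx_d K i u) = cx_d T i (F p i u).
Proof. exact: (kosz_map_d (base_mapB p) (base_mapZ p) (base_map_d p)). Qed.

Let F_quasi_iso n i : quasi_iso_on (F 'X^n) (fun j => GT j n%:Z) i.
Proof.
apply: (kosz_map_quasi_iso base0 base_res0 (base_mapB _) (base_mapZ _)
  (base_map_d _) _ (base_map_homog n) (base_quasi_iso n)).
by move=> x _; apply: base_stable.
Qed.

Let T_exact_neg k i : exact_on (fun j => GT j (Negz k)) i.
Proof.
apply: (@kosz_exact _ base_res base_res0 _ _ i.+1 _ _ i (ltnSn i)).
  by move=> y /mapP [c _ ->]; apply: base_stable.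
by move=> j _; apply: base_exact_neg.
Qed.

(** The scalars [c] making [c z] a coboundary form an ideal, which contains each generator by
    null-homotopy. *)
Let K_null i (z : K i.+1) (c : A) :
  I c -> cx_d K i.+1 z = 0 -> exists w, c *: z = cx_d K i w.
Proof.
move=> + dz; rewrite I_gen => hc; apply: (hc [set c | exists w, c *: z = cx_d K i w]).
  split=> [|a b [u au] [v bv]|a b [u bu]] /=.
  - by exists 0; rewrite scale0r linear0.
  - by exists (u + v); rewrite scalerDl au bv linearD.
  - by exists (a *: u); rewrite -scalerA bu linearZ.
move=> x xs_x /=; have [h [hl hE]] := kosz_null_homotopic base0 xs_x.
exists (h i z); rewrite -hE dz.
by have [g gE] := linear_bundle (hl i.+1); rewrite -gE linear0 addr0.
Qed.

(** Each monomial of [p] contributes the image under [F 'X^k] of [p_k z], a coboundary since [p_k]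
    is in [I]. *)
Let F_boundary i (z : K i.+1) (p : {poly A}) : cx_d K i.+1 z = 0 ->
  (forall k, I p`_k) -> exists w, F p i.+1 z = cx_d T i w.
Proof.
move=> dz hp; rewrite -[p]coefK poly_def.
apply: (big_ind (fun q => exists w, F q i.+1 z = cx_d T i w)).
- exists 0; rewrite linear0 -(scale0r (F 0 i.+1 z)); apply/esym.
  apply: (@kosz_map_scaler _ _ _ base_res _ _ 0 (base_map 0) (base_map 0)) => j u.
  by rewrite base_map_scaler mulr0.
- move=> q r [u qu] [v rv]; exists (u + v); rewrite linearD -qu -rv.
  by apply: kosz_mapD => j y; apply: base_mapD.
- move=> k _; have [w wE] := K_null (hp k) dz.
  exists (F 'X^k i w); rewrite -F_d -wE; apply/esym.
  by apply: kosz_map_scalel => j y; apply: base_map_scalel.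
Qed.

Let F_plus i (z : K i.+1) n (r : rees I) : cx_d K i.+1 z = 0 -> rees_plus I r ->
  exists w, r *: F 'X^n i.+1 z = cx_d T i w.
Proof.
move=> dz hr; have [|w wE] := @F_boundary i z (val r * 'X^n) dz.
  move=> k; rewrite coefMXn; case: ifP => _; first by case: idI.
  exact: rees_plus_coef.
exists w; rewrite -wE; apply: kosz_map_scaler => j u; exact: base_map_scaler.
Qed.

Let nonzero_class (m : nat) :=
  exists z : K m.+1, cx_d K m.+1 z = 0 /\ forall w, z <> cx_d K m w.

Let nonzero_class_ex : exists m, `[< nonzero_class m >].
Proof.
have hx : {in xs, forall x, I x} by move=> x hx; rewrite I_gen => L _; apply.
(* The surviving class sits in the top degree, the number of generators. *)
have [N [u [_ du Nu Nd _]]] := kosz_has_top hx (base_has_top idI I_proper).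
exists (size xs + 0)%N; apply/asboolP; exists u; split=> // w uw.
by apply: Nu; rewrite uw.
Qed.

(* The least degree where Koszul cohomology does not vanish: the grade of I. *)
Definition grade : nat := ex_minn nonzero_class_ex.

(** A cocycle is split into homogeneous cocycles: negative degrees are exact, and in the others the
    class comes from [K], where it vanishes by minimality of [grade]. *)
Let T_exact i : (i < grade)%N -> exact_on (fun=> setT : set (T _)) i.
Proof.
rewrite /grade; case: ex_minnP => g _ g_min ig z _ dz.
have [s [c [hc dc ->]]] := homog_kernel (f := cx_d T i.+1) (GT_grading _)
  (GT_grading _) (@GT_homogeneous_d i.+1) dz.
apply: (big_ind (fun y => exists2 w, setT w & y = cx_d T i w)).
- by exists 0; rewrite ?linear0.
- by move=> u v [a _ ->] [b _ ->]; exists (a + b); rewrite ?linearD.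
move=> n _; have := hc n; have := dc n; case: n => k dk hk; last first.
  by have [w _ ->] := T_exact_neg hk dk; exists w.
have [y [w [dy _ ->]]] := (F_quasi_iso k i).2 _ hk dk.
have [v ->] : exists v, y = cx_d K i v.
  apply: contrapT => hy; have /g_min : `[< nonzero_class i >].
    by apply/asboolP; exists y; split=> // v yv; apply: hy; exists v.
  by rewrite leqNgt ig.
by exists (F 'X^k i v + w); rewrite // linearD -F_d.
Qed.

Lemma local_cohomology_class (n : nat) :
  exists2 i, (i <= grade)%N &
    exists x : E i, cocycles (rees_plus I) n%:Z x /\
                    ~ coboundaries (rees_plus I) n%:Z x.
Proof.
apply: contrapT => none; pose J := rees_plus I; pose g := grade.
have [z [dz nz]] : nonzero_class g.
  by rewrite /g /grade; case: ex_minnP => m /asboolP.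
pose Q i : set (base_res i) := base_gr i n%:Z `&` torsion J (M := base_res i).
(* If no class exists up to degree [g], the torsion strand of the resolution is exact there. *)
have base_ex i : (i < g.+1)%N -> exact_on Q i.
  move=> ig x [xn xJ] dx; apply: contrapT => nx; apply: none; exists i => //.
  exists x; split=> // xb; apply: nx; destruct i as [|i].
    exists 0; last by rewrite linear0; exact: xb.
    by split=> //; exists 0%N => r _; rewrite scaler0.
  by case: xb => y [yn yJ ->]; exists y.
have Qs : {in [seq rees_const x | x <- xs], forall x, stable_under x Q}.
  move=> y /mapP [c _ ->]; have [hB hZ] := base_stable c n%:Z.
  split=> [i u v [u1 u2] [v1 v2]|i u [u1 u2]].
    by split; [apply: hB | apply: torsionB].
  by split; [apply: hZ | apply: torsionZ].
have GTP i : is_graded_module GR (GT i) by case: (GT_injective i).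
(* Taking [phi] to be the identity gives [d h d = d]: the map [d h] fixes the coboundaries of degree
   [g]. *)
have [||||h [hh hE _]] := @null_homotopy _ _ T T GT GT GTP GT_homogeneous_d GTP
  GT_homogeneous_d (fun i => GT_injective i.+1) (fun i => idfun) _ _ _ g _ => //.
  by move=> u; apply: (kosz0 base_res0).
pose u := F 'X^n g.+1 z.
have du : cx_d T g.+1 u = 0.
  rewrite /u -F_d dz.
  exact: (morph0 (@kosz_mapB _ _ _ _ rees_const _ (base_mapB 'X^n) xs)).
have hu : GT g.+1 n%:Z u by apply: kosz_map_set; apply: base_map_homog.
(* This [v] is cohomologous to [u], and for [r] in [J] the element [r u] is a coboundary, hence
   fixed by [d h], so [r v = 0]. *)
pose v := u - cx_d T g (h u).
have vJ : torsion J v.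
  exists 1%N => r hr; have {}hr : J r.
    apply: hr => [|_ [a [b [ha _ ->]]]]; last first.
      by rewrite /J /rees_plus /mkset rmorphM /= coef0M [X in X * _]ha mul0r.
    split=> [|a b ha hb|a b hb]; rewrite /J /rees_plus /mkset /=.
    - by rewrite coef0.
    - by rewrite coefD ha hb addr0.
    - by rewrite coef0M [X in _ * X]hb mulr0.
  have [w wE] := F_plus n dz hr.
  by rewrite scalerBr -linearZ_LR -linearZ_LR wE hE subrr.
have vn : GT g.+1 n%:Z v.
  by apply: (gradingB (GT_grading _)) => //; apply: GT_homogeneous_d; apply: hh.
have dv : cx_d T g.+1 v = 0 by rewrite linearB cx_dd du subrr.
(* Exactness of the torsion strand passes to its Koszul complex and bounds [v], hence [u];
   injectivity of [F 'X^n] on cohomology then makes [z] a coboundary. *)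
have [w wQ vw] := kosz_exact base_res0 Qs base_ex (ltnSn g) (kosz_set_torsion vn vJ) dv.
have wn : GT g n%:Z w by apply: kosz_set_mono wQ => i a [].
have [|//|y zy] := (F_quasi_iso n g).1 z (w + h u) dz _ _.
- by apply: (gradingD (GT_grading _)) => //; apply: hh.
- by rewrite linearD -vw subrK.
exact: (nz y).
Qed.

End Rees.

Theorem lemma1p3 (A : comNzRingType) (m : set A) (d : nat) (I : set A) :
  noetherian_ring A -> local_ring m -> krull_dim A d -> primary_to m I ->
  exists i : nat,
    infinite_set
      [set n : nat | local_cohomology_neq0 (rees_plus I) (rees_gpoly I) i n%:Z].
Proof.
move=> noeth _ _ [[[idI I1] _] _].
have [xs I_gen] := noeth I idI.
(* Nonvanishing quantifies over all resolutions, so if there were none, [i = 0] would serve for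
   every [n]; otherwise one resolution [E] is fixed. *)
have [noE|/contrapT [E _]] := pselect (~ exists E : injResolution (rees_gpoly I), True).
  exists 0 => fin; apply: infinite_nat; apply: sub_finite_set fin => n _ E.
  by case: noE; exists E.
apply: contrapT => fin; apply: infinite_nat.
pose X i := [set n : nat | local_cohomology_neq0 (rees_plus I) (rees_gpoly I) i n%:Z].
(* The bound [grade] is independent of [n], so if each [X i] were finite, finitely many of them
   would cover all naturals. *)
have hX : [set: nat] `<=` \bigcup_(i in `I_(grade I_gen I1).+1) X i.
  move=> n _; have [i ig [x hx]] := local_cohomology_class E I_gen I1 n.
  exists i => // E'; apply: cohomology_resolution_indep; exists x; exact: hx.
apply: (sub_finite_set hX); apply: bigcup_finite; first exact: finite_II.
by move=> i _; apply: contrapT => inf; apply: fin; exists i.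
Qed.
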